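(* Let $\mathcal Y=[0,1]$ and let the loss be $\ell(y,y')=K(y,y')$, the Kullback-Leibler divergence between Bernoulli distributions with respective parameters $y$ and $y'$. For any training set size $n\ge1$, positive integer $d$ and input space $\mathcal X$ containing at least $\lfloor\log_2(2d)\rfloor$ points, there exists a set $\mathcal G$ of $d$ prediction functions such that: for any estimator $\hat g$ there exists a probability distribution on the data space $\mathcal X\times[0,1]$ for which $$\mathbb ER(\hat g)-\min_{g\in\mathcal G}R(g)\ge e^{-1}(\log2)\,\min\Big(1,\frac{\lfloor\log_2|\mathcal G|\rfloor}{n+1}\Big).$$
   Context: $K(y,y')=y\log\frac y{y'}+(1-y)\log\frac{1-y}{1-y'}$. A prediction function is a measurable map $\mathcal X\to\mathcal Y$. For a distribution $P$ on $\mathcal X\times\mathcal Y$, $R(g)=\mathbb E_{(X,Y)\sim P}\ell[Y,g(X)]$. An estimator maps a training set $Z_1^n\in(\mathcal X\times\mathcal Y)^n$ to a prediction function (measurably), and $\mathbb ER(\hat g)$ is its expected risk when $Z_1^n\sim P^{\otimes n}$. $\lfloor x\rfloor$ is the largest integer $k\le x$.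
   Formalization: The formal theorem assumes that the sigma-algebra on the input space separates points; with, for example, the trivial sigma-algebra all prediction functions are constant and the claimed bound fails. *)

(* Defs.v *)
From HB Require Import structures.
From mathcomp Require Import all_boot all_order all_algebra finmap.
From mathcomp Require Import all_classical all_reals all_analysis.

Set Implicit Arguments.
Unset Strict Implicit.
Unset Printing Implicit Defensive.

Import Order.TTheory GRing.Theory Num.Theory.
Import numFieldNormedType.Exports.

Local Open Scope classical_set_scope.
Local Open Scope ring_scope.

Definition i01_val (R : realType) (y : {i01 R}) : R := y%:num.

HB.instance Definition _ (R : realType) :=
  isPointed.Build {i01 R} (0%:i01 : {i01 R}).

(* [0,1] carries the trace of the Borel sigma-algebra of R. *)
HB.instance Definition _ (R : realType) :=
  Measurable.copy {i01 R} (g_sigma_algebra_preimageType (@i01_val R)).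

Section power_probability.
Context {R : realType}.
Local Open Scope ereal_scope.

Section product_probability.
Context d1 d2 (T1 : measurableType d1) (T2 : measurableType d2).
Variables (P1 : probability T1 R) (P2 : probability T2 R).

Definition product_probability : set (T1 * T2) -> \bar R := P1 \x P2.

HB.instance Definition _ := Measure.on product_probability.

Let product_probability_setT : product_probability [set: T1 * T2] = 1.
Proof.
rewrite -setXTT [LHS]product_measure1E// -[RHS]mule1.
by congr (_ * _); exact: probability_setT.
Qed.

HB.instance Definition _ := Measure_isProbability.Build _ _ _
  product_probability product_probability_setT.

End product_probability.

Context d (T : measurableType d).

Definition tuple_cons n (u : T * n.-tuple T) : n.+1.-tuple T :=
  [tuple of u.1 :: u.2].

Lemma measurable_tuple_cons n : measurable_fun setT (@tuple_cons n).
Proof. exact: measurable_cons. Qed.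

HB.instance Definition _ n := isMeasurableFun.Build _ _ _ _
  (@tuple_cons n) (@measurable_tuple_cons n).

(* The n-fold product of P, on the space of n-tuples. *)
Fixpoint power_probability (P : probability T R) n :
    probability (n.-tuple T) R :=
  match n with
  | 0 => dirac ([tuple] : 0.-tuple T)
  | n'.+1 => distribution (product_probability P (power_probability P n'))
               (@tuple_cons n')
  end.

Lemma power_probabilityE (P : probability T R) n (A : 'I_n -> set T) :
  (forall i, measurable (A i)) ->
  power_probability P n [set t | forall i, A i (tnth t i)] =
  \prod_(i < n) P (A i).
Proof.
elim: n A => [|n IHn] A mA /=.
  by rewrite big_ord0 diracE mem_set// => -[].
rewrite big_ord_recl -IHn; last by move=> i; exact: mA.
set B := [set t | forall i, A (lift ord0 i) (tnth t i)].
have mB : measurable B.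
  rewrite (_ : B = \big[setI/setT]_(i < n) (@tnth n T ^~ i @^-1` A (lift ord0 i))).
    apply: bigsetI_measurable => i _; rewrite -[X in measurable X]setTI.
    exact: measurable_tnth.
  rewrite -bigcap_seq/=; apply/seteqP; split => t Bt i //=.
  by apply: Bt; rewrite /= mem_index_enum.
rewrite -product_measure1E//; congr (_ _).
apply/seteqP; split => -[x t] /=.
  move=> At; split => [|i]; first exact: (At ord0).
  by have := At (lift ord0 i); rewrite tnthS.
by move=> [Ax Bt] i; case: (unliftP ord0 i) => [j|] ->; rewrite ?tnthS ?tnth0//; apply: Bt.
Qed.

End power_probability.

Section learning.
Context {R : realType}.
Local Open Scope ereal_scope.

(* a * log (a / b) for a, b >= 0, with 0 log (0 / b) = 0, including b = 0,
   and a log (a / 0) = +oo for a > 0. *)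
Definition xlogxy (a b : R) : \bar R :=
  if a == 0%R then 0 else if b == 0%R then +oo else (a * ln (a / b))%R%:E.

(* The addition is never of the form +oo - oo, as xlogxy never takes the
   value -oo. *)
Definition KL (y y' : {i01 R}) : \bar R :=
  xlogxy y%:num y'%:num + xlogxy (1 - y%:num) (1 - y'%:num).

Context {disp : measure_display} {X : measurableType disp}.

Definition risk (P : probability (X * {i01 R})%type R)
    (g : {mfun X >-> {i01 R}}) : \bar R :=
  \int[P]_z KL z.2 (g z.1).

(* Joint measurability in the training set and the new input. *)
Definition measurable_estimator n
    (ghat : n.-tuple (X * {i01 R})%type -> {mfun X >-> {i01 R}}) : Prop :=
  measurable_fun setT
    (fun u : (n.-tuple (X * {i01 R}) * X)%type => ghat u.1 u.2).

Definition expected_risk (P : probability (X * {i01 R})%type R) n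
    (ghat : n.-tuple (X * {i01 R})%type -> {mfun X >-> {i01 R}}) : \bar R :=
  \int[power_probability P n]_z risk P (ghat z).

End learning.

Definition log2 {R : realType} (x : R) : R := ln x / ln 2.

Definition separates_points d (T : measurableType d) : Prop :=
  forall x y : T, x <> y -> exists2 A : set T, measurable A & A x /\ ~ A y.

(* Main.v *)
(* Let m = floor (log2 d) and pick m + 1 points of X.  The family G contains, for
   every labelling s in {0,1}^m of m of these points, a {0,1}-valued function that
   takes the values s there, padded with constants in ]0,1[.  The distribution P_s
   puts mass 1/max(m, n+1) on each labelled point (x_j, s_j) and the rest on
   (x_0, 0), so that the function attached to s has zero risk.  When x_j is not in
   the sample, which has probability (1 - 1/max(m, n+1))^n >= 1/e, the training
   sets under s and under s with its j-th bit flipped coincide, while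
   K(0,p) + K(1,p) >= 2 log 2 for every p.  Averaging over s gives the bound. *)
From HB Require Import structures.
Require Import Defs.
From mathcomp Require Import all_boot all_order all_algebra finmap.
From mathcomp Require Import all_classical all_reals all_analysis.
From mathcomp Require Import measurable_realfun ring lra.
Import Order.TTheory GRing.Theory Num.Theory.
Local Open Scope classical_set_scope.
Local Open Scope ring_scope.

Set Implicit Arguments.
Unset Strict Implicit.
Unset Printing Implicit Defensive.

(** * Finitely supported distributions and integration against their powers *)

Section mixture.
Context {R : realType} {disp : measure_display} {T : measurableType disp}.
Local Open Scope ereal_scope.

(** Characterised by integrals, the form in which risks meet [P]; this asks nothing about
    measurability of singletons. *)
Definition is_mixture N (w : 'I_N -> R) (z : 'I_N -> T) (P : probability T R) :=
  forall f : T -> \bar R, measurable_fun setT f -> (forall x, 0 <= f x) ->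
  \int[P]_x f x = \sum_(i < N) (w i)%:E * f (z i).

Lemma mixture_exists N (w : 'I_N -> R) (z : 'I_N -> T) :
  (forall i, 0 <= w i)%R -> (\sum_i w i = 1)%R -> exists P, is_mixture w z P.
Proof.
case: N w z => [|N] w z w0 w1.
  by move: w1; rewrite big_ord0 => /eqP; rewrite eq_sym oner_eq0.
(* [msum] is indexed by [nat], so the finite families are extended through [inord], whence the prior
   case split making ['I_N] inhabited. *)
pose a k : {nonneg R} := NngNum (w0 (inord k)).
pose mu : {measure set T -> \bar R} :=
  msum (fun k => mscale (a k) (dirac (z (inord k)))) N.+1.
have muE f : measurable_fun setT f -> (forall x, 0 <= f x) ->
    \int[mu]_x f x = \sum_(i < N.+1) (w i)%:E * f (z i).
  move=> mf f0; rewrite ge0_integral_measure_sum//; apply: eq_bigr => i _.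
  rewrite ge0_integral_mscale// integral_dirac// diracT mul1e /a/=.
  by rewrite inord_val.
have mu1 : mu setT = 1.
  rewrite -[LHS]mul1e -integral_cst// muE//=; under eq_bigr do rewrite mule1.
  by rewrite sumEFin w1.
pose P : probability T R :=
  HB.pack (Measure.sort mu) (Measure.class mu)
    (Measure_isProbability.Build _ _ _ mu mu1).
by exists P => f mf f0; rewrite -muE.
Qed.

Lemma integral_power_probability0 (P : probability T R) (F : 0.-tuple T -> \bar R) :
  measurable_fun setT F ->
  \int[power_probability P 0]_t F t = F [tuple].
Proof.
by move=> mF; rewrite /= integral_dirac ?diracT ?mul1e.
Qed.

Lemma integral_mixture_powerS N (w : 'I_N -> R) z (P : probability T R) n
    (F : n.+1.-tuple T -> \bar R) :
  is_mixture w z P -> measurable_fun setT F -> (forall t, 0 <= F t) ->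
  \int[power_probability P n.+1]_t F t =
  \sum_i (w i)%:E * \int[power_probability P n]_t F (tuple_cons (z i, t)).
Proof.
move=> Pmix mF F0.
have mFc : measurable_fun setT (F \o @tuple_cons _ T n).
  exact: (measurableT_comp mF (@measurable_tuple_cons _ T n)).
have Fc0 x : 0 <= (F \o @tuple_cons _ T n) x by exact: F0.
rewrite [LHS]ge0_integral_distribution//.
rewrite [LHS](@fubini_tonelli1 _ _ _ _ _ P (power_probability P n))//.
rewrite Pmix//; first exact: measurable_fun_fubini_tonelli_F.
by move=> x; apply: integral_ge0 => t _.
Qed.

(* P and P' differ only in the location of the atom j: on the samples that avoid it,
   of mass (1 - w j) ^+ n, F and F' are evaluated at the same point. *)
Lemma power_probability_pair N (w : 'I_N -> R) z z' (P P' : probability T R) j :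
  is_mixture w z P -> is_mixture w z' P' ->
  (forall i, 0 <= w i)%R -> (\sum_i w i = 1)%R ->
  (forall i, i != j -> z i = z' i) ->
  forall n (F F' : n.-tuple T -> \bar R) (c : R), (0 <= c)%R ->
  measurable_fun setT F -> measurable_fun setT F' ->
  (forall t, 0 <= F t) -> (forall t, 0 <= F' t) ->
  (forall t, c%:E <= F t + F' t) ->
  (c * (1 - w j) ^+ n)%:E <=
  \int[power_probability P n]_t F t + \int[power_probability P' n]_t F' t.
Proof.
move=> Pmix P'mix w0 w1 zz'; elim=> [|n IHn] F F' c c0 mF mF' F0 F'0 FF'.
  by rewrite !integral_power_probability0// expr0 mulr1.
rewrite (integral_mixture_powerS Pmix)// (integral_mixture_powerS P'mix)//.
have int_ge0 (Q : probability T R) (G : n.+1.-tuple T -> \bar R) x :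
    (forall t, 0 <= G t) ->
    0 <= \int[power_probability Q n]_t G (tuple_cons (x, t)).
  by move=> G0; exact: integral_ge0.
rewrite -big_split/= exprS mulrCA.
have w1j : (1 - w j = \sum_(i | i != j) w i)%R.
  by apply/eqP; rewrite subr_eq -w1 (bigD1 j)//= addrC.
(* The atom [j] is dropped from the right-hand side. Any other first draw is common to both samples,
   and the induction hypothesis applies to the remaining [n] draws. *)
rewrite [X in (X * _)%R]w1j mulr_suml -sumEFin [leRHS](bigD1 j)//=.
rewrite -[leLHS]add0e leeD ?adde_ge0 ?mule_ge0 ?lee_fin ?int_ge0//.
apply: lee_sum => i ij; rewrite -ge0_muleDr ?int_ge0// EFinM.
rewrite lee_wpmul2l ?lee_fin// -zz'//.
have mcons (G : n.+1.-tuple T -> \bar R) : measurable_fun setT G ->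
    measurable_fun setT (fun t => G (tuple_cons (z i, t))).
  move=> mG; apply: (measurableT_comp mG).
  exact: (measurableT_comp (@measurable_tuple_cons _ T n)).
by apply: IHn => //; exact: mcons.
Qed.

End mixture.

(** * The Kullback-Leibler loss: measurability, binary labels, nonnegativity *)

Section KL.
Context {R : realType}.
Local Open Scope ereal_scope.

Let i01_ge0 (y : {i01 R}) : (0 <= y%:num)%R. Proof. by []. Qed.
Let i01_le1 (y : {i01 R}) : (y%:num <= 1)%R. Proof. by []. Qed.

Lemma measurable_i01_val : measurable_fun setT (@i01_val R).
Proof. by move=> _ B mB; exists B. Qed.

Lemma measurable_fun_i01 d (T : measurableType d) (f : T -> {i01 R}) :
  measurable_fun setT (@i01_val R \o f) -> measurable_fun setT f.
Proof.
move=> mf _ _ [B mB <-]; rewrite setTI [X in _ `&` X]/preimage setTI.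
by have := mf measurableT B mB; rewrite setTI.
Qed.

Lemma measurable_xlogxy d (T : measurableType d) (f g : T -> R) :
  measurable_fun setT f -> measurable_fun setT g ->
  (forall x, 0 <= f x)%R -> (forall x, 0 <= g x)%R ->
  measurable_fun setT (fun x => xlogxy (f x) (g x)).
Proof.
move=> mf mg f0 g0.
(* Once both zero cases are split off, the logarithm of the quotient is a difference of
   logarithms. *)
apply: (@eq_measurable_fun _ _ _ _ _ (fun x => if f x == 0%R then 0 else
   if g x == 0%R then +oo else (f x * (ln (f x) - ln (g x)))%:E)).
  move=> x _; rewrite /xlogxy; case: eqP => // /eqP fx0; case: eqP => // /eqP gx0.
  by rewrite ln_div// posrE lt_neqAle eq_sym ?fx0 ?gx0 ?f0 ?g0.
apply: measurable_fun_ifT => //; first exact: measurable_fun_eqr.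
apply: measurable_fun_ifT => //; first exact: measurable_fun_eqr.
apply/measurable_EFinP; apply: measurable_funM => //.
by apply: measurable_funB; apply: measurableT_comp => //; exact: measurable_ln.
Qed.

Lemma measurable_KL d (T : measurableType d) (f g : T -> {i01 R}) :
  measurable_fun setT f -> measurable_fun setT g ->
  measurable_fun setT (fun x => KL (f x) (g x)).
Proof.
move=> /(measurableT_comp measurable_i01_val) mf.
move=> /(measurableT_comp measurable_i01_val) mg.
apply: emeasurable_funD; apply: measurable_xlogxy => //.
- exact: measurable_funB.
- exact: measurable_funB.
Qed.

Definition i01_bool (b : bool) : {i01 R} := if b then 1%:i01%R else 0%:i01%R.

Lemma xlogxy0 b : xlogxy 0 b = 0 :> \bar R.
Proof. by rewrite /xlogxy eqxx. Qed.

Lemma xlogxy1 b : (0 <= b)%R ->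
  xlogxy 1 b = (if b == 0%R then +oo else (- ln b)%:E) :> \bar R.
Proof.
move=> b0; rewrite /xlogxy oner_eq0; case: eqP => // /eqP bn0.
by rewrite mul1r div1r lnV// posrE lt_neqAle eq_sym bn0.
Qed.

Lemma KL_bool b (y : {i01 R}) : KL (i01_bool b) y =
  let p := (if b then y%:num else 1 - y%:num)%R in
  if p == 0%R then +oo else (- ln p)%:E.
Proof.
case: b; rewrite /KL/= ?subrr ?subr0 xlogxy0 xlogxy1 ?subr_ge0//.
  by rewrite adde0.
by rewrite add0e.
Qed.

Lemma KL_bool_refl b : KL (i01_bool b) (i01_bool b) = 0.
Proof. by rewrite KL_bool; case: b; rewrite /= ?subr0 oner_eq0 ln1 oppr0. Qed.

(** For 0 < p < 1 the sum is -log(p(1-p)), and 1/4 - p(1-p) = (p - 1/2)^2. At p = 0 or p = 1 one of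
    the terms is infinite. *)
Lemma KL_bool_pair b (y : {i01 R}) :
  (2 * ln 2)%:E <= KL (i01_bool b) y + KL (i01_bool (~~ b)) y.
Proof.
wlog -> : b / b = true.
  by move=> /(_ true erefl); case: b => //; rewrite addeC.
rewrite !KL_bool/=; have := i01_ge0 y; have := i01_le1 y.
set p := y%:num => p1 p0.
have [->|pn0] := eqVneq p 0%R; first by case: ifP => _; rewrite ?leey.
case: ifPn => [_|qn0]; first by rewrite leey.
have pgt0 : (0 < p)%R by rewrite lt_neqAle eq_sym pn0.
have qgt0 : (0 < 1 - p)%R by rewrite lt_neqAle eq_sym qn0 subr_ge0.
rewrite -EFinD lee_fin -opprD -lnM ?posrE// lerNr.
have -> : (- (2 * ln 2) = ln (2 ^- 2) :> R)%R.
  by rewrite lnV ?posrE ?exprn_gt0// lnXn// mulr_natl.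
rewrite ler_ln ?posrE ?mulr_gt0 ?invr_gt0 ?exprn_gt0//.
rewrite -subr_ge0 (_ : _ - _ = (p - 2^-1) ^+ 2)%R ?sqr_ge0//.
by field.
Qed.

(** This is log t <= t - 1 at t = b/a. In [KL_ge0] the linear bounds of the two terms add up to
    zero. *)
Lemma xlogxy_ge (a b : R) : (0 <= a)%R -> (0 <= b)%R ->
  (a - b)%:E <= xlogxy a b.
Proof.
move=> a0 b0; rewrite /xlogxy; case: eqP => [->|/eqP an0].
  by rewrite lee_fin sub0r oppr_le0.
case: eqP => [_|/eqP bn0]; first by rewrite leey.
have agt0 : (0 < a)%R by rewrite lt_neqAle eq_sym an0.
have bgt0 : (0 < b)%R by rewrite lt_neqAle eq_sym bn0.
rewrite lee_fin -[(a / b)%R]invrK invf_div lnV ?posrE ?divr_gt0//.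
have -> : (a - b = a * - (b / a - 1))%R by field.
rewrite ler_pM2l// lerN2.
have := le_ln1Dx (x := (b / a - 1)%R).
by rewrite (_ : 1 + _ = b / a)%R; [apply|ring]; rewrite ltrBrDl subrr divr_gt0.
Qed.

Lemma KL_ge0 (y y' : {i01 R}) : 0 <= KL y y'.
Proof.
have := leeD (xlogxy_ge (i01_ge0 y) (i01_ge0 y'))
  (@xlogxy_ge (1 - y%:num) (1 - y'%:num) _ _).
rewrite !subr_ge0 => /(_ (i01_le1 y) (i01_le1 y')); apply: le_trans.
by rewrite -EFinD lee_fin; lra.
Qed.

End KL.

(** * Averaging arguments and numerical estimates *)

Lemma mean_le_exists (R : realType) (I : finType) (i0 : I) (a : I -> \bar R) (c : R) :
  (forall i, 0 <= a i)%E -> ((#|I|%:R * c)%:E <= \sum_i a i)%E ->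
  exists i, (c%:E <= a i)%E.
Proof.
move=> a0 leca; apply: contrapT => /forallNP nle.
have ltac i : (a i < c%:E)%E by rewrite ltNge; apply/negP/nle.
have afin i : a i \is a fin_num by rewrite ge0_fin_numE// (lt_trans (ltac i)) ?ltey.
move: leca; under eq_bigr do rewrite -(fineK (afin _)).
rewrite sumEFin lee_fin leNgt mulr_natl -sumr_const => /negP; apply.
apply: ltr_sum => [|i _]; first by apply/hasP; exists i0; rewrite ?mem_index_enum.
by rewrite -lte_fin fineK.
Qed.

(** An injection of a finite type permutes it, so summing the hypothesis over [i] bounds twice the
    sum. Arguing by contradiction replaces halving in the extended reals by doubling a strict
    inequality. *)
Lemma sum_ge_of_pairing (R : realType) (I : finType) (h : I -> I)
    (a : I -> \bar R) (c : R) : injective h ->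
  (forall i, (2 * c)%:E <= a i + a (h i))%E ->
  ((#|I|%:R * c)%:E <= \sum_i a i)%E.
Proof.
move=> h_inj leca; rewrite leNgt; apply/negP => lt_sum.
have := lteD lt_sum lt_sum; rewrite ltNge => /negP; apply.
rewrite [X in (_ <= _ + X)%E](reindex_inj h_inj)/= -big_split/=.
have -> : ((#|I|%:R * c)%:E + (#|I|%:R * c)%:E = \sum_(i : I) (2 * c)%:E)%E.
  by rewrite sumEFin sumr_const -EFinD; congr EFin; rewrite -mulr_natl; ring.
exact: lee_sum.
Qed.

(** Multiplied by log 2, the inequalities defining the floor k become 2^k <= d < 2^(k+1). *)
Lemma floor_log2 (R : realType) d : (0 < d)%N ->
  Num.floor (log2 (d%:R : R)) = trunc_log 2 d.
Proof.
move=> d0; apply: floor_def.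
have ln2_gt0 : 0 < ln 2 :> R by rewrite ln_gt0// ltr1n.
have lnX k : k%:R * ln 2 = ln (2 ^ k)%:R :> R.
  by rewrite natrX lnXn// mulr_natl.
have posX k : (0 < 2 ^ k)%N by rewrite expn_gt0.
rewrite -[(_ + 1)%R]/(Posz (trunc_log 2 d + 1)) addn1 !pmulrn.
rewrite /log2 ler_pdivlMr// ltr_pdivrMr// !lnX.
by rewrite ler_ln ?ltr_ln ?posrE ?ltr0n// ler_nat ltr_nat trunc_logP// trunc_log_ltn.
Qed.

(** The hypotheses force M >= 2, so 1 - 1/M is the inverse of 1 + 1/(M-1), and (1 + 1/(M-1))^n <=
    exp(n/(M-1)) <= e. *)
Lemma expRN1_le (R : realType) (n M : nat) : (n < M)%N -> (0 < n)%N ->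
  expR (-1) <= (1 - M%:R^-1) ^+ n :> R.
Proof.
case: M => [|[|M]]// nM n0; first by case: n nM n0.
have -> : 1 - M.+2%:R^-1 = (1 + M.+1%:R^-1)^-1 :> R.
  have -> : M.+2%:R = M.+1%:R + 1 :> R by rewrite [in LHS]mulrS addrC.
  have M0 : 0 < M.+1%:R :> R by rewrite ltr0n.
  by field; rewrite !gt_eqF// ltr_wpDl// ltW.
rewrite expRN exprVn lef_pV2 ?posrE ?expR_gt0 ?exprn_gt0 ?addr_gt0//.
apply: (@le_trans _ _ (expR (M.+1%:R^-1) ^+ n)).
  by rewrite lerXn2r ?nnegrE ?expR_ge0 ?addr_ge0 ?expR_ge1Dx.
by rewrite -expRM_natl ler_expR ler_pdivrMr ?mul1r ?ler_nat ?ltr0n.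
Qed.

(** * Functions and expected risks determined by finitely many points *)

Section construction.
Context {R : realType} {disp : measure_display} {X : measurableType disp}.

(** Singletons of [X] may fail to be measurable. Their substitute is a finite intersection, over j
    <> i, of measurable sets containing [x i] but not [x j]. *)
Lemma separating_sets N (x : 'I_N -> X) : separates_points X -> injective x ->
  exists A : 'I_N -> set X,
    (forall i, measurable (A i)) /\ (forall i j, A i (x j) <-> i = j).
Proof.
move=> X_sep x_inj.
have /choice[B B_sep] (u : 'I_N * 'I_N) : exists B : set X,
    measurable B /\ (u.1 != u.2 -> B (x u.1) /\ ~ B (x u.2)).
  have [uu|u12] := eqVneq u.1 u.2; first by exists setT.
  have /X_sep[B mB sepB] : x u.1 <> x u.2 by move/x_inj/eqP; rewrite (negbTE u12).
  by exists B.
exists (fun i => \bigcap_(j in [set j | i != j]) B (i, j)); split.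
  move=> i; apply: fin_bigcap_measurable; first exact: finite_finset.
  by move=> j _; have [] := B_sep (i, j).
move=> i j; split=> [Aij|<- k ik]; last by have [_ /(_ ik)[]] := B_sep (i, k).
by apply: contrapT => /eqP ij; have [_ /(_ ij)[_]] := B_sep (i, j); apply; exact: Aij.
Qed.

Lemma interpolation N (x : 'I_N -> X) (s : 'I_N -> bool) :
  separates_points X -> injective x ->
  exists g : {mfun X >-> {i01 R}}, forall i, g (x i) = i01_bool (s i).
Proof.
move=> X_sep x_inj; have [A [mA Ax]] := separating_sets X_sep x_inj.
pose U := \bigcup_(i in [set i | s i]) A i.
have mU : measurable U by apply: fin_bigcup_measurable => //; exact: finite_finset.
pose f y : {i01 R} := i01_bool (y \in U).
have mf : measurable_fun setT f.
  apply: measurable_fun_i01.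
  apply: (@eq_measurable_fun _ _ _ _ _ (\1_U : X -> R)).
    by move=> y _; rewrite /= indicE /f; case: (y \in U).
  exact: measurable_indic.
exists (HB.pack_for {mfun X >-> {i01 R}} f (isMeasurableFun.Build _ _ _ _ f mf)).
move=> i /=; rewrite /f; congr i01_bool.
by apply/idP/idP => [/set_mem[j sj /Ax <-]|si]//; apply/mem_set; exists i => //; apply/Ax.
Qed.

(** Isolates the contribution of each atom, so that labellings can later be paired atom by atom. *)
Lemma expected_risk_mixture N (w : 'I_N -> R) (z : 'I_N -> X * {i01 R})
    (P : probability (X * {i01 R})%type R) n
    (ghat : n.-tuple (X * {i01 R}) -> {mfun X >-> {i01 R}}) :
  (forall i, 0 <= w i) -> is_mixture w z P -> measurable_estimator ghat ->
  expected_risk P ghat =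
  (\sum_i (w i)%:E *
     \int[power_probability P n]_t KL (z i).2 (ghat t (z i).1))%E.
Proof.
move=> w0 Pmix mghat; rewrite /expected_risk.
have mi i : measurable_fun setT (fun t => KL (z i).2 (ghat t (z i).1)).
  apply: measurable_KL => //.
  exact: (measurableT_comp mghat (pair2_measurable (z i).1)).
under eq_integral => t _.
  rewrite /risk Pmix; [over| |].
  - apply: measurable_KL; first exact: measurable_snd.
    by apply: measurableT_comp => //; exact: measurable_fst.
  - by move=> ?; exact: KL_ge0.
rewrite ge0_integral_sum//=.
- apply: eq_bigr => i _; rewrite ge0_integralZl_EFin//.
  by move=> t _; exact: KL_ge0.
- by move=> i; apply: emeasurable_funM.
- by move=> i t _; rewrite mule_ge0 ?lee_fin ?KL_ge0.
Qed.

End construction.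

(** * Binary labellings and bit flips *)

Section hypercube.
Variable m : nat.
Implicit Types (s : {ffun 'I_m -> bool}) (j : 'I_m).

(** Index [ord0] is the atom carrying the leftover mass, with label 0 for every [s]; the bits of [s]
    label the others. *)
Definition label s (i : 'I_m.+1) : bool := oapp s false (unlift ord0 i).

Definition flip j s : {ffun 'I_m -> bool} := [ffun k => (k == j) (+) s k].

Lemma flip_inj j : injective (flip j).
Proof. by apply: inv_inj => s; apply/ffunP => k; rewrite !ffunE addbA addbb. Qed.

Lemma label_lift s j : label s (lift ord0 j) = s j.
Proof. by rewrite /label liftK. Qed.

Lemma label_flip_lift s j :
  label (flip j s) (lift ord0 j) = ~~ label s (lift ord0 j).
Proof. by rewrite !label_lift ffunE eqxx. Qed.

Lemma label_flip s j i : i != lift ord0 j -> label (flip j s) i = label s i.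
Proof.
rewrite /label; case: unliftP => [k ->|->]//=; rewrite (inj_eq lift_inj) ffunE.
by move=> /negbTE ->.
Qed.

End hypercube.

(** * The averaged lower bound and the family of predictors *)

Section lower_bound.
Context {R : realType} {disp : measure_display} {X : measurableType disp}.

Lemma risk_ge0 (P : probability (X * {i01 R})%type R) g : (0 <= risk P g)%E.
Proof. by apply: integral_ge0 => z _; exact: KL_ge0. Qed.

Lemma hard_labelling_exists m n (x : 'I_m.+1 -> X) (w : 'I_m.+1 -> R) (v : R)
    (P : {ffun 'I_m -> bool} -> probability (X * {i01 R})%type R)
    (ghat : n.-tuple (X * {i01 R}) -> {mfun X >-> {i01 R}}) :
  (forall i, 0 <= w i) -> \sum_i w i = 1 ->
  (forall j, w (lift ord0 j) = v) ->
  (forall s, is_mixture w (fun i => (x i, i01_bool (label s i))) (P s)) ->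
  measurable_estimator ghat ->
  exists s, ((m%:R * v * (1 - v) ^+ n * ln 2)%:E <= expected_risk (P s) ghat)%E.
Proof.
move=> w0 w1 wv Pmix mghat.
apply: (mean_le_exists [ffun=> false]) => [s|].
  by apply: integral_ge0 => t _; exact: risk_ge0.
have a0 s i : (0 <= (w i)%:E * \int[power_probability (P s) n]_t
    KL (i01_bool (label s i)) (ghat t (x i)))%E.
  rewrite mule_ge0 ?lee_fin//.
  by apply: integral_ge0 => t _; exact: KL_ge0.
under eq_bigr => s _ do rewrite (expected_risk_mixture w0 (Pmix s) mghat)/=.
(* With the sum over atoms outermost, the term of [ord0] is bounded below by 0, and each other atom
   must contribute v (1-v)^n log 2 on average over [s]. *)
rewrite exchange_big big_ord_recl/=.
set card_s := #|_|.
have -> : card_s%:R * (m%:R * v * (1 - v) ^+ n * ln 2) =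
    0 + \sum_(j < m) card_s%:R * (v * (1 - v) ^+ n * ln 2).
  by rewrite add0r sumr_const card_ord -mulr_natl; ring.
rewrite EFinD -sumEFin; apply: leeD; first by apply: sume_ge0 => s _; exact: a0.
apply: lee_sum => j _; apply: (@sum_ge_of_pairing _ _ (flip j)) => [|s].
  exact: flip_inj.
have -> : 2 * (v * (1 - v) ^+ n * ln 2) =
  w (lift ord0 j) * (2 * ln 2 * (1 - w (lift ord0 j)) ^+ n) by rewrite wv; ring.
have int_ge0 s' : (0 <= \int[power_probability (P s') n]_t
    KL (i01_bool (label s' (lift ord0 j))) (ghat t (x (lift ord0 j))))%E.
  by apply: integral_ge0 => t _; exact: KL_ge0.
rewrite -ge0_muleDr// EFinM lee_wpmul2l ?lee_fin//.
have mKL b : measurable_fun setT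
    (fun t => KL (i01_bool b) (ghat t (x (lift ord0 j)))).
  apply: measurable_KL => //.
  exact: (measurableT_comp mghat (pair2_measurable _)).
(* The two mixtures differ only at atom [lift ord0 j]; on a common sample the estimator predicts one
   value there, against opposite labels. *)
apply: (power_probability_pair (Pmix s) (Pmix (flip j s))) => //.
- by move=> i ij; rewrite label_flip.
- by rewrite mulr_ge0 ?ln_ge0 ?ler1n.
- by move=> t; exact: KL_ge0.
- by move=> t; exact: KL_ge0.
- by move=> t; rewrite label_flip_lift; exact: KL_bool_pair.
Qed.

Lemma prediction_family (m k : nat) (x : 'I_m.+1 -> X) :
  separates_points X -> injective x ->
  exists f : {ffun 'I_m -> bool} + 'I_k -> {mfun X >-> {i01 R}},
    injective f /\ forall s i, f (inl s) (x i) = i01_bool (label s i).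
Proof.
move=> X_sep x_inj.
have /choice[g gE] (s : {ffun 'I_m -> bool}) :
    exists g : {mfun X >-> {i01 R}}, forall i, g (x i) = i01_bool (label s i).
  exact: interpolation.
(* The padding constants 1/(i+2) are pairwise distinct and, being neither 0 nor 1, differ from every
   [g s] at [x ord0]. *)
have i2_gt0 i : 0 < i.+2%:R^-1 :> R by rewrite invr_gt0 ltr0n.
have i2_lt1 i : i.+2%:R^-1 < 1 :> R by rewrite invf_lt1 ?ltr0n// ltr1n.
pose c (i : 'I_k) : {i01 R} := Itv01 (ltW (i2_gt0 i)) (ltW (i2_lt1 i)).
exists (fun u => match u with inl s => g s | inr i => cst (c i) end).
split=> [|s i]; last exact: gE.
have bool_neqc b i : i01_bool b <> c i.
  move=> /(congr1 (@i01_val R)); rewrite /i01_val; case: b => /= /eqP.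
    by rewrite gt_eqF.
  by rewrite lt_eqF.
move=> [s|i] [s'|i'] /(congr1 (fun h : {mfun X >-> {i01 R}} => (h : X -> {i01 R}))) E.
- congr inl; apply/ffunP => j.
  have := congr1 (@i01_val R) (congr1 (@^~ (x (lift ord0 j))) E).
  rewrite /= !gE !label_lift /i01_val.
  by case: (s j) (s' j) => -[]//= /eqP; rewrite ?oner_eq0// eq_sym oner_eq0.
- by have /= := congr1 (@^~ (x ord0)) E; rewrite gE => /bool_neqc.
- by have /= := congr1 (@^~ (x ord0)) E; rewrite gE => /esym/bool_neqc.
- have /= /(congr1 (@i01_val R)) := congr1 (@^~ (x ord0)) E.
  by rewrite /i01_val/= => /invr_inj/eqP; rewrite eqr_nat => /eqP[/val_inj ->].
Qed.

End lower_bound.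

Theorem theorem8p10 (R : realType) (n d : nat) (n_gt0 : (0 < n)%N)
    (d_gt0 : (0 < d)%N) (disp : measure_display) (X : measurableType disp)
    (X_sep : separates_points X)
    (X_card : (`I_ `|Num.floor (log2 (2 * d%:R : R))|%N #<= [set: X])%card) :
  exists G : {fset {mfun X >-> {i01 R}}},
    #|` G|%fset = d /\
    forall ghat : n.-tuple (X * {i01 R}) -> {mfun X >-> {i01 R}},
      measurable_estimator ghat ->
      exists P : probability (X * {i01 R})%type R,
        (expected_risk P ghat - \big[mine/+oo]_(g <- G) risk P g >=
         (expR (-1) * ln 2 *
          Num.min 1 ((Num.floor (log2 (#|` G|%fset%:R : R)))%:~R / n.+1%:R))%:E)%E.
Proof.
pose m := trunc_log 2 d.
(* The floor of log2(2d) is m + 1: one point per bit and one for the leftover mass. *)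
have [x x_inj] : exists x : 'I_m.+1 -> X, injective x.
  move: X_card; rewrite -natrM floor_log2 ?muln_gt0// mul2n trunc_log2_double//.
  move=> /pcard_injP[y y_inj]; exists (fun i : 'I_m.+1 => y i) => i j yij.
  by apply/val_inj/y_inj => //; apply/mem_set => /=.
have [f [f_inj fE]] := @prediction_family R _ _ m (d - 2 ^ m) x X_sep x_inj.
pose G := [fset f u | u : {ffun 'I_m -> bool} + 'I_(d - 2 ^ m)]%fset.
have Gd : #|` G|%fset = d.
  rewrite card_imfset//= -cardE card_sum card_ffun card_bool !card_ord.
  by rewrite subnKC// trunc_logP.
exists G; split=> // ghat mghat; rewrite Gd floor_log2// -/m.
(* M >= m leaves a nonnegative mass 1 - m/M for [ord0], and M > n gives (1 - 1/M)^n >= 1/e. *)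
pose M := maxn m n.+1.
have M_gt0 : 0 < M%:R :> R by rewrite ltr0n leq_max orbT.
pose w (i : 'I_m.+1) : R := if i == ord0 then 1 - m%:R / M%:R else M%:R^-1.
have w0 i : 0 <= w i.
  rewrite /w; case: eqP => _; last by rewrite invr_ge0 ltW.
  by rewrite subr_ge0 ler_pdivrMr// mul1r ler_nat leq_maxl.
have w1 : \sum_i w i = 1.
  rewrite big_ord_recl/= {1}/w eqxx.
  under eq_bigr do rewrite /w/=.
  by rewrite sumr_const card_ord -[_^-1 *+ _]mulr_natl subrK.
have /choice[P Pmix] (s : {ffun 'I_m -> bool}) :
    exists P, is_mixture w (fun i => (x i, i01_bool (label s i) : {i01 R})) P.
  exact: mixture_exists.
have [s le_s] := hard_labelling_exists w0 w1 (fun=> erefl) Pmix mghat.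
exists (P s).
(* The minimum over [G] is thus at most 0, and a lower bound on the expected risk is one on the
   excess risk. *)
have risk_s : risk (P s) (f (inl s)) = 0%E.
  rewrite /risk Pmix; last by move=> ?; exact: KL_ge0.
    by rewrite big1// => i _; rewrite /= fE KL_bool_refl mule0.
  apply: measurable_KL; first exact: measurable_snd.
  by apply: measurableT_comp => //; exact: measurable_fst.
have min_le0 : (\big[mine/+oo]_(g <- G) risk (P s) g <= 0)%E.
  rewrite -risk_s; apply: ge_bigmin_seq => //.
  by apply/imfsetP; exists (inl s).
apply: (@le_trans _ _ (expected_risk (P s) ghat)); last first.
  by rewrite -[leLHS]adde0; apply: leeD => //; rewrite oppe_ge0.
apply: le_trans le_s; rewrite lee_fin.
(* The total mass m/M of the labelled atoms is exactly the minimum in the claimed rate. *)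
have -> : Num.min 1 ((Posz m)%:~R / n.+1%:R) = m%:R / M%:R :> R.
  rewrite -pmulrn /M; have [mn|nm] := leqP m n.+1.
    by apply/min_idPr; rewrite ler_pdivrMr ?ltr0n// mul1r ler_nat.
  have m0 : 0 < m%:R :> R by rewrite ltr0n (leq_trans _ nm).
  rewrite divff ?gt_eqF//; apply/min_idPl.
  by rewrite ler_pdivlMr ?ltr0n// mul1r ler_nat ltnW.
rewrite mulrC mulrA ler_wpM2r ?ln_ge0 ?ler1n// ler_wpM2l//.
by apply: expRN1_le => //; rewrite leq_maxr.
Qed.
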